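(* There exist $2$-circulant Butson Hadamard matrices $BH(62,6)$, $BH(82,6)$ and $BH(146,6)$.
   Context: A Butson Hadamard matrix $BH(n,q)$ is an $n\times n$ complex matrix all of whose entries are $q$th roots of unity and whose rows are pairwise orthogonal with respect to the standard complex inner product on $\mathbb{C}^n$. A $BH(2p,q)$ matrix is called $2$-circulant if it has the block form $H=\begin{bmatrix} X & Y\\ Y^\ast & -X^\ast\end{bmatrix}$ where $X$ and $Y$ are $p\times p$ circulant matrices (here $Y^\ast$ is the conjugate transpose). *)

(* Defs.v *)
From mathcomp Require Import all_boot all_order all_algebra.
From mathcomp Require Import sesquilinear spectral.
From mathcomp Require Import complex reals.

Set Implicit Arguments.
Unset Strict Implicit.
Unset Printing Implicit Defensive.

Import GRing.Theory Num.Theory.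
Local Open Scope ring_scope.
Local Open Scope sesquilinear_scope.

Definition butson_hadamard (C : numClosedFieldType) (n q : nat)
    (H : 'M[C]_n) : Prop :=
  (forall i j : 'I_n, q.-unity_root (H i j)) /\
  (forall i k : 'I_n, i != k -> dotmx (row i H) (row k H) = 0).

(* [ordS] is the successor modulo n: each row is the previous one rotated one
   step to the right, with wrap-around. *)
Definition circulant (T : Type) (n : nat) (X : 'M[T]_n) : Prop :=
  forall i j : 'I_n, X (ordS i) (ordS j) = X i j.

Definition two_circulant (C : numClosedFieldType) (p : nat)
    (H : 'M[C]_(p + p)) : Prop :=
  exists X Y : 'M[C]_p,
    [/\ circulant X, circulant Y & H = block_mx X Y (Y ^t*) (- (X ^t*))].

(* Main.v *)
Require Import Defs.
From mathcomp Require Import all_boot all_order all_algebra.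
From mathcomp Require Import sesquilinear spectral.
From mathcomp Require Import complex reals.
From mathcomp Require Import ring.
Local Open Scope ring_scope.

(** Put [X = (x_(j-i))] and [Y = (y_(j-i))].  As circulant matrices commute with
    each other and with their adjoints, the rows of [H] are orthogonal as soon
    as [X X* + Y Y*] is diagonal, i.e. as soon as the periodic autocorrelations
    of [x] and [y] add up to zero at every nonzero shift.  Suitable [x] and [y]
    are constant on the cosets of the subgroup of index [e] of the
    multiplicative group modulo [p], with [e = 6] for [p = 31] and [e = 8] for
    [p = 41] and [p = 73]; the values on the cosets were found by a
    meet-in-the-middle search.  Writing the entries as powers of a primitive
    sixth root of unity [z], one has [z^2 = z - 1], so that the vanishing of an
    autocorrelation is a comparison of the multiplicities of the exponents
    modulo 6. *)

Set Implicit Arguments.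
Unset Strict Implicit.
Unset Printing Implicit Defensive.

Import GRing.Theory Num.Theory.
Local Open Scope sesquilinear_scope.

(** Sizes are written [n.+2] so that the indices form the nontrivial ring of integers modulo the
    size. *)
Lemma ordS_addr1 (n : nat) (i : 'I_n.+2) : ordS i = i + 1.
Proof. by apply: val_inj => /=; rewrite modnDmr addn1. Qed.

Lemma circulant_shift (T : Type) (n : nat) (X : 'M[T]_n.+2) (k i j : 'I_n.+2) :
  circulant X -> X (i + k) (j + k) = X i j.
Proof.
move=> cX; rewrite -[k]natr_Zp; elim: (k : nat) => [|m IH].
  by rewrite !addr0.
by rewrite -natr1 !addrA -!ordS_addr1 cX.
Qed.

(** The involution [k -> i + j - k] of the summation index swaps the two factors, up to a
    simultaneous shift of row and column in each. *)
Lemma circulant_mulmxC (R : comPzRingType) (n : nat) (X Y : 'M[R]_n.+2) :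
  circulant X -> circulant Y -> X *m Y = Y *m X.
Proof.
move=> cX cY; apply/matrixP => i j; rewrite !mxE.
rewrite (reindex_inj (h := fun k => i + j - k)) /=; last first.
  by move=> k l /addrI /oppr_inj.
apply: eq_bigr => k _; rewrite mulrC; congr (_ * _).
  by rewrite -(circulant_shift (k - j) _ _ cY); congr (Y _ _); ring.
by rewrite -(circulant_shift (k - i) _ _ cX); congr (X _ _); ring.
Qed.

Lemma circulant_trmxC (C : numClosedFieldType) (n : nat) (X : 'M[C]_n) :
  circulant X -> circulant (X ^t*).
Proof. by move=> cX i j; rewrite !mxE cX. Qed.

Definition circulant_mx (T : Type) (n : nat) (x : 'I_n.+2 -> T) : 'M[T]_n.+2 :=
  \matrix_(i, j) x (j - i).

Lemma circulant_mxP (T : Type) (n : nat) (x : 'I_n.+2 -> T) :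
  circulant (circulant_mx x).
Proof. by move=> i j; rewrite !mxE !ordS_addr1; congr x; ring. Qed.

Definition autocorrelation (C : numClosedFieldType) (n : nat)
    (x : 'I_n.+2 -> C) (s : 'I_n.+2) : C :=
  \sum_(t < n.+2) x (t + s) * (x t)^*.

Lemma mul_circulant_mx_trmxC (C : numClosedFieldType) (n : nat)
    (x : 'I_n.+2 -> C) (i k : 'I_n.+2) :
  (circulant_mx x *m (circulant_mx x) ^t*) i k = autocorrelation x (k - i).
Proof.
rewrite mxE (reindex_inj (addIr k)) /=; apply: eq_bigr => t _.
by rewrite !mxE addrK addrA.
Qed.

Definition two_circulant_mx (C : numClosedFieldType) (n : nat)
    (x y : 'I_n.+2 -> C) : 'M[C]_(n.+2 + n.+2) :=
  let X := circulant_mx x in let Y := circulant_mx y in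
  block_mx X Y (Y ^t*) (- (X ^t*)).

Lemma dotmx_row (C : numClosedFieldType) (n : nat) (H : 'M[C]_n) (i k : 'I_n) :
  dotmx (row i H) (row k H) = (H *m H ^t*) i k.
Proof. by rewrite dotmxE !mxE; apply: eq_bigr => j _; rewrite !mxE. Qed.

Lemma two_circulant_mx_butson (C : numClosedFieldType) (n q : nat)
    (x y : 'I_n.+2 -> C) :
    ~~ odd q ->
    (forall t, q.-unity_root (x t)) -> (forall t, q.-unity_root (y t)) ->
    (forall s, s != 0 -> autocorrelation x s + autocorrelation y s = 0) ->
  butson_hadamard q (two_circulant_mx x y) /\
  two_circulant (two_circulant_mx x y).
Proof.
move=> q_even ux uy xy0; split; last first.
  exists (circulant_mx x), (circulant_mx y).
  by split=> //; apply: circulant_mxP.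
rewrite /two_circulant_mx.
have cX := circulant_mxP x; have cY := circulant_mxP y.
have XY i k : i != k ->
    (circulant_mx x *m (circulant_mx x) ^t* +
     circulant_mx y *m (circulant_mx y) ^t*) i k = 0.
  move=> ik; rewrite mxE !mul_circulant_mx_trmxC xy0 // subr_eq0.
  by rewrite eq_sym.
have uX i j : q.-unity_root (circulant_mx x i j) by rewrite mxE.
have uY i j : q.-unity_root (circulant_mx y i j) by rewrite mxE.
move: (circulant_mx x) (circulant_mx y) cX cY XY uX uY => X Y cX cY XY uX uY.
have uconj (z : C) : q.-unity_root z -> q.-unity_root z^*.
  by move=> /unity_rootP zq; apply/unity_rootP; rewrite -rmorphXn zq rmorph1.
split=> [i j|i k].
  case: (split_ordP i) => i' ->; case: (split_ordP j) => j' ->.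
  - by rewrite block_mxEul.
  - by rewrite block_mxEur.
  - by rewrite block_mxEdl !mxE uconj.
  rewrite block_mxEdr !mxE unity_rootE exprNn -signr_odd (negbTE q_even) mul1r.
  by rewrite -unity_rootE uconj.
rewrite dotmx_row tr_block_mx map_block_mx mulmx_block.
rewrite linearN /= map_mxN !trmxCK !mulmxN !mulNmx opprK.
(* The off-diagonal blocks of [H *m H ^t*] are now commutators of circulants, and the lower diagonal
   block equals the upper one after commuting each factor with its adjoint. *)
have cXt := circulant_trmxC cX; have cYt := circulant_trmxC cY.
rewrite (circulant_mulmxC cX cY) (circulant_mulmxC cYt cXt) !subrr.
rewrite [_ + X ^t* *m X]addrC.
rewrite (circulant_mulmxC cXt cX) (circulant_mulmxC cYt cY).
case: (split_ordP i) => i' ->; case: (split_ordP k) => k' ->.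
- by rewrite block_mxEul (inj_eq (@lshift_inj _ _)); apply: XY.
- by rewrite block_mxEur mxE.
- by rewrite block_mxEdl mxE.
by rewrite block_mxEdr (inj_eq (@rshift_inj _ _)); apply: XY.
Qed.

(** The powers 0 to 5 of [z] are 1, z, z - 1, -1, -z, 1 - z; the two equations say that the constant
    coefficient and that of [z] cancel. *)
Definition zero_sixth_root_sum (s : seq nat) : bool :=
  let c r := count (fun m => m %% 6 == r)%N s in
  (c 0 + c 5 == c 2 + c 3)%N && (c 1 + c 2 == c 4 + c 5)%N.

Lemma sixth_root_cube (R : comPzRingType) (z : R) :
  z ^+ 2 = z - 1 -> z ^+ 3 = -1.
Proof. by move=> z2; rewrite exprS z2 mulrBr mulr1 -expr2 z2; ring. Qed.

Lemma zero_sixth_root_sumP (R : comPzRingType) (z : R) (s : seq nat) :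
  z ^+ 2 = z - 1 -> zero_sixth_root_sum s -> \sum_(m <- s) z ^+ m = 0.
Proof.
move=> z2; have z3 := sixth_root_cube z2.
have z6 m : z ^+ m = z ^+ (m %% 6).
  rewrite {1}(divn_eq m 6) exprD mulnC exprM (exprM z 3 2) z3 sqrrN !expr1n.
  by rewrite mul1r.
pose c r := count (fun m => m %% 6 == r)%N s.
have ->: \sum_(m <- s) z ^+ m =
    (c 0 + c 5)%:R - (c 2 + c 3)%:R + ((c 1 + c 2)%:R - (c 4 + c 5)%:R) * z.
  rewrite {}/c; elim: s => [|m s IH]; first by rewrite big_nil /=; ring.
  rewrite big_cons {}IH /= z6.
  have: (m %% 6 < 6)%N by rewrite ltn_mod.
  have z4 : z ^+ 4 = - z by rewrite exprS z3; ring.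
  have z5 : z ^+ 5 = 1 - z by rewrite exprS z4 mulrN -expr2 z2; ring.
  by case: (m %% 6)%N => [|[|[|[|[|[|]]]]]] //= _; rewrite ?z2 ?z3 ?z4 ?z5; ring.
by case/andP=> /eqP e1 /eqP e2; rewrite /c e1 e2 !subrr mul0r addr0.
Qed.

Lemma primitive_sixth_root_exists (C : numClosedFieldType) :
  exists z : C, z ^+ 2 = z - 1 /\ z^* = z ^+ 5.
Proof.
pose z : C := (1 + sqrtC (- 3)) / 2.
have z2 : z ^+ 2 = z - 1.
  have w2 : sqrtC (- 3 : C) ^+ 2 = - 3 by rewrite sqrtCK.
  rewrite /z; move: (sqrtC _) w2 => w w2.
  have -> : ((1 + w) / 2) ^+ 2 = (1 + 2 * w + w ^+ 2) / 4 by field.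
  by rewrite w2; field.
exists z; split=> //.
have z3 := sixth_root_cube z2.
have z6 : z * z ^+ 5 = 1 by rewrite -exprS (exprM z 3 2) z3; ring.
(* A root of unity has norm 1, so its conjugate is its inverse, here [z ^+ 5]. *)
have zn : `|z| = 1.
  apply/eqP; rewrite -(@pexpr_eq1 _ _ 6) //.
  by rewrite -normrX exprS z6 normr1.
have z0 : z != 0 by rewrite -normr_eq0 zn oner_eq0.
by apply: (mulfI z0); rewrite z6 -normCK zn expr1n.
Qed.

(** Multiplication by [5] modulo 6 is complex conjugation on exponents. *)
Definition complementary_exponents (p : nat) (a b : seq nat) : bool :=
  let corr (c : seq nat) (s : nat) :=
    [seq nth 0 c ((t + s) %% p) + 5 * nth 0 c t | t <- iota 0 p]%N in
  all (fun s => zero_sixth_root_sum (corr a s ++ corr b s)) (iota 1 p.-1).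

(** This trades the complex matrix for a boolean test on lists of naturals, which can be decided by
    computation. *)
Lemma complementary_exponents_butson (C : numClosedFieldType) (n : nat)
    (a b : seq nat) :
    complementary_exponents n.+2 a b ->
  exists H : 'M[C]_(n.+2 + n.+2), butson_hadamard 6 H /\ two_circulant H.
Proof.
move=> /allP ab; have [z [z2 zconj]] := primitive_sixth_root_exists C.
have z3 := sixth_root_cube z2.
have z6 : z ^+ 6 = 1 by rewrite (exprM z 3 2) z3; ring.
pose x (c : seq nat) (t : 'I_n.+2) := z ^+ nth 0%N c t.
have ux c t : 6.-unity_root (x c t).
  by rewrite unity_rootE /x -exprM mulnC exprM z6 expr1n.
have corrE c (s : 'I_n.+2) : autocorrelation (x c) s =
    \sum_(m <- [seq nth 0 c ((t + s) %% n.+2) + 5 * nth 0 c t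
                | t <- iota 0 n.+2]%N) z ^+ m.
  rewrite big_map -[iota 0 _]/(index_iota 0 n.+2) big_mkord.
  by apply: eq_bigr => t _; rewrite exprD exprM -zconj rmorphXn.
exists (two_circulant_mx (x a) (x b)); apply: two_circulant_mx_butson => // s s0.
rewrite !corrE -big_cat; apply: zero_sixth_root_sumP => //.
apply: ab; rewrite mem_iota add1n ltn_ord andbT lt0n.
by apply: contra s0 => /eqP s0; apply/eqP/val_inj.
Qed.

(** Exponent [0] at [0], and [c_(k mod e)] at [g^k], where [e] is the length of
    [c] and [g] is a primitive root modulo [p]. *)
Definition cyclotomic_exponents (p g : nat) (c : seq nat) : seq nat :=
  let powers := traject (fun u => g * u %% p)%N 1%N p.-1 in
  0%N :: [seq nth 0 c (index t powers %% size c) | t <- iota 1 p.-1]%N.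

Theorem theorem4p1 (R : realType) :
  (exists H : 'M[R[i]]_62,
     butson_hadamard 6 H /\ two_circulant (p := 31) H) /\
  (exists H : 'M[R[i]]_82,
     butson_hadamard 6 H /\ two_circulant (p := 41) H) /\
  (exists H : 'M[R[i]]_146,
     butson_hadamard 6 H /\ two_circulant (p := 73) H).
Proof.
split; [|split].
(* The generators 3, 6 and 5 are the least primitive roots modulo 31, 41 and 73. The arguments 29,
   39 and 71 are [p - 2], and 62 is convertible to [31 + 31], and so on. *)
- pose e := cyclotomic_exponents 31 3.
  apply: (@complementary_exponents_butson _ 29
    (e [:: 1; 1; 5; 4; 2; 4]%N) (e [:: 3; 5; 2; 0; 3; 4]%N)).
  by vm_compute.
- pose e := cyclotomic_exponents 41 6.
  apply: (@complementary_exponents_butson _ 39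
    (* Here [x] takes only the values 1 and -1, and [y] is already constant on the cosets of the
       subgroup of index 4. *)
    (e [:: 0; 0; 3; 3; 3; 0; 3; 3]%N) (e [:: 2; 5; 4; 1; 2; 5; 4; 1]%N)).
  by vm_compute.
pose e := cyclotomic_exponents 73 5.
apply: (@complementary_exponents_butson _ 71
  (e [:: 3; 0; 5; 2; 4; 5; 3; 1]%N) (e [:: 5; 0; 3; 5; 1; 4; 2; 3]%N)).
by vm_compute.
Qed.
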